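(* There are infinitely many natural numbers $m$ such that the symmetric group $S_m$ satisfies $h_{\rm OD}(S_m)>3$. In particular, there is no upper bound for $h_{\rm OD}(S_m)$ (that is, for every natural number $N$ there is a natural number $m$ with $h_{\rm OD}(S_m)>N$).
   Context: All groups are finite. $S_m$ denotes the symmetric group on $m$ letters. For a finite group $G$, $\pi(G)$ is the set of prime divisors of $|G|$. The prime graph $\Gamma(G)$ is the simple graph with vertex set $\pi(G)$ in which two distinct primes $p,q$ are adjacent if and only if $G$ contains an element of order $pq$. For $p\in\pi(G)$, $\deg(p)$ is the number of edges of $\Gamma(G)$ incident with $p$. If $p_1<p_2<\cdots<p_k$ are the prime divisors of $|G|$, the degree pattern of $G$ is ${\rm D}(G)=(\deg(p_1),\deg(p_2),\ldots,\deg(p_k))$. For a finite group $H$, $h_{\rm OD}(H)$ denotes the number of isomorphism classes of finite groups $G$ such that $|G|=|H|$ and ${\rm D}(G)={\rm D}(H)$. *)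

(* Defs.v *)
From mathcomp Require Import all_boot all_fingroup all_solvable.

Set Implicit Arguments.
Unset Strict Implicit.
Unset Printing Implicit Defensive.

Import GroupScope.

Definition prime_graph (gT : finGroupType) (G : {group gT}) : rel nat :=
  fun p q => [&& p \in primes #|G|, q \in primes #|G|, p != q
              & [exists x in G, #[x] == (p * q)%N]].

Definition prime_degree (gT : finGroupType) (G : {group gT}) (p : nat) : nat :=
  count (prime_graph G p) (primes #|G|).

(* [primes] lists the prime divisors in increasing order. *)
Definition degree_pattern (gT : finGroupType) (G : {group gT}) : seq nat :=
  [seq prime_degree G p | p <- primes #|G|].

Definition OD_equal (gT rT : finGroupType) (G : {group gT}) (H : {group rT})
    : bool :=
  (#|G| == #|H|) && (degree_pattern G == degree_pattern H).

(* By Cayley's theorem every group of order n is isomorphic to a subgroup of  *)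
(* 'S_n, so the isomorphism classes of finite groups of order #|H| are the    *)
(* classes under \isog of the subgroups of 'S_#|H| of that order; hOD_spec    *)
(* below checks that no finite group is missed.                               *)
Definition hOD (gT : finGroupType) (H : {group gT}) : nat :=
  #|equivalence_partition
      (fun K L : {group 'S_#|H|} => K \isog L)
      [set K : {group 'S_#|H|} | OD_equal K H]|.

Lemma prime_graph_isog (gT rT : finGroupType) (G : {group gT})
    (H : {group rT}) :
  G \isog H -> prime_graph G =2 prime_graph H.
Proof.
have half (aT bT : finGroupType) (A : {group aT}) (B : {group bT}) n :
    A \isog B -> [exists x in A, #[x] == n] -> [exists x in B, #[x] == n].
  case/isogP=> f injf <- /exists_inP[x Ax /eqP ox].
  by apply/exists_inP; exists (f x); rewrite ?mem_morphim ?order_injm ?ox.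
move=> isoGH p q; rewrite /prime_graph (card_isog isoGH); do 3!congr (_ && _).
by apply/idP/idP; apply: half; rewrite // isog_sym.
Qed.

Lemma OD_equal_isog (gT rT : finGroupType) (G : {group gT}) (H : {group rT}) :
  G \isog H -> OD_equal G H.
Proof.
move=> isoGH; rewrite /OD_equal (card_isog isoGH) eqxx /=.
rewrite /degree_pattern (card_isog isoGH); apply/eqP/eq_map=> p.
rewrite /prime_degree (card_isog isoGH).
exact/eq_count/prime_graph_isog.
Qed.

Lemma OD_equal_trans (aT bT cT : finGroupType)
    (A : {group aT}) (B : {group bT}) (C : {group cT}) :
  OD_equal A B -> OD_equal B C -> OD_equal A C.
Proof. by case/andP=> /eqP oAB /eqP dAB; rewrite /OD_equal oAB dAB. Qed.

Lemma isog_Cayley (gT : finGroupType) (G : {group gT}) (n : nat) :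
  #|G| = n -> exists K : {group 'S_n}, G \isog K.
Proof.
move=> oG; have oT : #|{: subg_of G}| = n by rewrite card_sub -oG.
pose e (x : subg_of G) : 'I_n := cast_ord oT (enum_rank x).
pose d (i : 'I_n) : subg_of G := enum_val (cast_ord (esym oT) i).
have eK : cancel e d by move=> x; rewrite /d /e cast_ordK enum_rankK.
have dK : cancel d e by move=> i; rewrite /d /e enum_valK cast_ordKV.
have inj_tr x : injective (fun i => e (d i * x)).
  by move=> i j /(can_inj eK)/mulIg/(can_inj dK).
pose phi x : 'S_n := perm (inj_tr x).
have phiM : {in [set: subg_of G] &, {morph phi : x y / x * y}}.
  by move=> x y _ _; apply/permP=> i; rewrite permM !permE eK mulgA.
pose f := Morphism phiM.
exists (f @* [set: subg_of G])%G; apply: isog_trans (isog_subg G) _.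
rewrite sub_isog //; apply/injmP=> x y _ _ /permP/(_ (e 1)).
by rewrite !permE eK !mul1g => /(can_inj eK).
Qed.

Lemma hOD_spec (gT : finGroupType) (H : {group gT}) :
  exists (rT : finGroupType) (r : 'I_(hOD H) -> {group rT}),
    [/\ forall i, OD_equal (r i) H,
        forall i j, r i \isog r j -> i = j
      & forall (aT : finGroupType) (G : {group aT}),
          OD_equal G H -> exists i, G \isog r i].
Proof.
set D := [set K : {group 'S_#|H|} | OD_equal K H].
pose R := fun K L : {group 'S_#|H|} => K \isog L.
have eqR : {in D & &, equivalence_rel R}.
  move=> K L M _ _ _; split; first exact: isog_refl.
  by move=> isoKL; apply/idP/idP; apply: isog_trans; rewrite // isog_sym.
pose P := equivalence_partition R D.
have partP : partition P D by exact: equivalence_partitionP.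
have [/eqP covP tiP P0] := and3P partP.
have rP (i : 'I_(hOD H)) : exists K : {group 'S_#|H|}, K \in enum_val i.
  apply/set0Pn; apply: contraNneq P0 => <-; exact: enum_valP.
have rE i : xchoose (rP i) \in enum_val i := xchooseP (rP i).
have rD i : xchoose (rP i) \in D.
  by rewrite -covP; apply/bigcupP; exists (enum_val i); rewrite ?enum_valP.
exists 'S_#|H|, (fun i => xchoose (rP i)); split.
- by move=> i; have:= rD i; rewrite inE.
- move=> i j isoij; apply: enum_val_inj.
  have: xchoose (rP j) \in pblock P (xchoose (rP i)).
    by rewrite (pblock_equivalence_partition eqR).
  rewrite (def_pblock tiP (enum_valP i) (rE i)) => rji.
  by rewrite -(def_pblock tiP (enum_valP i) rji)
             (def_pblock tiP (enum_valP j) (rE j)).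
move=> aT G odG; have /andP[/eqP oG _] := odG.
have [K isoGK] := isog_Cayley oG.
have KD : K \in D.
  rewrite inE; apply: OD_equal_trans odG; apply: OD_equal_isog.
  by rewrite isog_sym.
have BP : pblock P K \in P by rewrite pblock_mem ?covP.
exists (enum_rank_in BP (pblock P K)); apply: isog_trans isoGK _.
rewrite -[_ \isog _]/(R _ _) -(pblock_equivalence_partition eqR) //.
by have := rE (enum_rank_in BP (pblock P K)); rewrite {2}enum_rankK_in.
Qed.

(* Main.v *)
Require Import Defs.
From mathcomp Require Import all_boot all_fingroup.
From mathcomp Require Import ssralg finalg zmodp matrix zify.
From mathcomp Require Import cyclic center pgroup abelian.

(** Write [m = 3 ^ n].  For an abelian group [K] of order [m], the group
['S_m.-1 * K] has order [m.-1`! * m = m`!], and it has the same prime graph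
as ['S_m] as soon as [m - 2] is composite.

- Two distinct primes [p], [r] are adjacent in the prime graph of ['S_k] iff
  [p + r <= k]: a permutation of order [p * r] either has a cycle of length
  divisible by [p * r] or has two disjoint cycles, one of length divisible by
  [p] and the other by [r], and conversely two disjoint cycles of lengths [p]
  and [r] will do ([exists_perm_order_mul_primes]).  So ['S_m.-1] and ['S_m]
  can differ only in edges with [p + r = m].  As [m] is odd, such an edge is
  [{2, m - 2}], and [m - 2] is composite.
- The factor [K] makes 3 adjacent to every other prime [r < m].  In ['S_m] it
  already is: [m - 1] is even, [m - 3] is divisible by 3, and [m - 2] is
  composite, so that [r + 3 <= m] ([OD_equal_Sym_prod]).

The group [K] is recovered, up to isomorphism, as the centre of ['S_m.-1 * K].
Hence non-isomorphic abelian groups of order [3 ^ n] give non-isomorphic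
groups with the order and degree pattern of ['S_m]; there are at least [n] of
them, with exponents [3], [3 ^ 2], ..., [3 ^ n] ([exponent_Zp_vec]).  So
[n <= hOD 'S_(3 ^ n)] whenever [3 ^ n - 2] is composite
([hOD_Sym_3exp]).  This happens for all [n = 4 * k + 3], since then
[3 ^ n = 81 ^ k * 27] is congruent to 2 modulo 5. *)

Set Implicit Arguments.
Unset Strict Implicit.
Unset Printing Implicit Defensive.

Import GroupScope.

(** * Permutations whose order is a product of two primes *)

Lemma card_porbit_dvd_order (T : finType) (s : {perm T}) x :
  #|porbit s x| %| #[s].
Proof. by rewrite porbitE; apply: dvdn_orbit. Qed.

Lemma order_dvd_porbits (T : finType) (s : {perm T}) k :
  (forall x, #|porbit s x| %| k) -> #[s] %| k.
Proof.
move=> dvd_k; rewrite order_dvdn; apply/eqP/permP=> x; rewrite perm1 permX.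
have /dvdnP[j ->] := dvd_k x.
by rewrite iterM; elim: j => //= j ->; rewrite iter_porbit.
Qed.

(** If [q] divided no cycle length, every cycle length, being a divisor of
[p * q], would divide [p], and so would the order of [s]. *)
Lemma porbit_prime_dvd (T : finType) (s : {perm T}) p q :
  prime p -> prime q -> #[s] = (p * q)%N -> exists x, q %| #|porbit s x|.
Proof.
move=> pr_p pr_q os; apply/existsP; rewrite -[X in is_true X]negbK negb_exists.
apply/negP=> /forallP no_q.
have /dvdn_leq : #[s] %| p.
  apply: order_dvd_porbits => x.
  have:= card_porbit_dvd_order s x; rewrite os Gauss_dvdl //.
  by rewrite coprime_sym prime_coprime // no_q.
rewrite os prime_gt0 // => /(_ isT).
by rewrite -{2}[p]muln1 leq_pmul2l ?prime_gt0 // leqNgt prime_gt1.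
Qed.

Lemma addn_leq_mul_gt1 p q : 1 < p -> 1 < q -> p + q <= (p * q)%N.
Proof. by move: p q => [|[|p]] [|[|q]] // _ _; nia. Qed.

(** Cauchy's theorem in the symmetric group of [A] spares the construction of
an explicit [p]-cycle. *)
Lemma exists_perm_on_prime_order (T : finType) (A : {set T}) p :
  prime p -> p <= #|A| -> exists2 s : {perm T}, perm_on A s & #[s] = p.
Proof.
move=> pr_p le_pA.
have /(Cauchy pr_p)[s] : p %| #|Sym_group A|.
  by rewrite card_Sym dvdn_fact ?prime_gt0.
by rewrite inE; exists s.
Qed.

(** A permutation of order [p * q] moves at least [p + q] points because
either one cycle has length at least [p * q >= p + q], or two disjoint cycles
have lengths at least [p] and [q].  The bound is attained by a product of
permutations of orders [p] and [q] with disjoint supports. *)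
Lemma exists_perm_order_mul_primes (T : finType) p q :
    prime p -> prime q -> p != q ->
  [exists s in [set: {perm T}], #[s] == (p * q)%N] = (p + q <= #|T|).
Proof.
move=> pr_p pr_q neq_pq; apply/exists_inP/idP=> [[s _ /eqP os] | le_pqT].
  have [x q_x] := porbit_prime_dvd pr_p pr_q os.
  have [y p_y] := porbit_prime_dvd pr_q pr_p (etrans os (mulnC p q)).
  have [eq_xy | neq_xy] := eqVneq (porbit s x) (porbit s y).
    have pq_y : (p * q)%N %| #|porbit s y|.
      by rewrite Gauss_dvd ?p_y -?eq_xy // prime_coprime // dvdn_prime2.
    apply: leq_trans (addn_leq_mul_gt1 (prime_gt1 pr_p) (prime_gt1 pr_q)) _.
    apply: leq_trans (max_card (mem (porbit s y))).
    by rewrite dvdn_leq // lt0n card_porbit_neq0.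
  have dis : [disjoint porbit s y & porbit s x].
    apply/pred0P=> z /=; apply: contraNF neq_xy => /andP[].
    by rewrite -!eq_porbit_mem => /eqP<- /eqP<-.
  have := max_card (mem (porbit s y :|: porbit s x)).
  rewrite cardsU disjoint_setI0 // cards0 subn0.
  apply: leq_trans; apply: leq_add; rewrite dvdn_leq //;
    by rewrite lt0n card_porbit_neq0.
have le_pT := leq_trans (leq_addr q p) le_pqT.
have /card_geqP[xs [/card_uniqP oxs sz_xs _]] := le_pT.
pose A := [set x in xs]; have oA : #|A| = p by rewrite cardsE oxs.
have [s sA os] := @exists_perm_on_prime_order T A p pr_p (eq_leq (esym oA)).
have [t tB ot] : exists2 t : {perm T}, perm_on (~: A) t & #[t] = q.
  apply: exists_perm_on_prime_order => //.
  by rewrite -(leq_add2l #|A|) cardsC oA.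
exists (s * t); rewrite ?inE // -os -ot orderM //.
  by apply: perm_onC sA tB _; rewrite -setI_eq0 setICr.
by rewrite os ot prime_coprime // dvdn_prime2.
Qed.

(** * The prime graph of a symmetric group *)

Lemma mem_primes_fact p n : (p \in primes n`!) = prime p && (p <= n).
Proof.
rewrite mem_primes fact_gt0 /=; case pr_p: (prime p) => //=.
apply/idP/idP=> [|le_pn]; last by rewrite dvdn_fact ?prime_gt0.
elim: n => [|n IHn]; first by rewrite dvdn1 => /eqP p1; rewrite p1 in pr_p.
by rewrite factS Euclid_dvdM // => /orP[/dvdn_leq-> // | /IHn/leqW].
Qed.

Lemma prime_graph_Sym n p r :
  prime_graph [set: 'S_n]%G p r = [&& prime p, prime r, p != r & p + r <= n].
Proof.
rewrite /prime_graph cardsT card_Sn !mem_primes_fact.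
case: (boolP (prime p)) => //= pr_p.
case: (boolP (prime r)) => [pr_r|]; last by rewrite andbF.
case: (eqVneq p r) => [->|neq_pr]; first by rewrite !andbF.
rewrite exists_perm_order_mul_primes // card_ord /=; lia.
Qed.

Lemma OD_equal_prime_graph (gT rT : finGroupType) (G : {group gT})
    (H : {group rT}) :
  #|G| = #|H| -> prime_graph G =2 prime_graph H -> OD_equal G H.
Proof.
move=> oGH eqGH; rewrite /OD_equal oGH eqxx; apply/eqP.
rewrite /degree_pattern oGH; apply: eq_map => p.
by rewrite /prime_degree oGH; apply: eq_count => r; apply: eqGH.
Qed.

(** * Direct products with the order and prime graph of a symmetric group *)

Lemma order_pairg1 (aT bT : finGroupType) (a : aT) :
  #[(a, 1) : aT * bT] = #[a].
Proof. exact: (order_injm (injm_pairg1 aT bT) (in_setT a)). Qed.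

Lemma expg_pair (aT bT : finGroupType) (x : aT * bT) n :
  x ^+ n = (x.1 ^+ n, x.2 ^+ n).
Proof. by elim: n => [|n IHn] //; rewrite !expgS IHn. Qed.

(** Raising to the power [#|bT|] kills the second component and, [n] being
prime to [#|bT|], preserves the order of an element of order [n]. *)
Lemma exists_order_prod (aT bT : finGroupType) n :
    coprime n #|bT| ->
  [exists x in [set: aT * bT], #[x] == n]
    = [exists a in [set: aT], #[a] == n].
Proof.
move=> co_n; apply/exists_inP/exists_inP=> [[x _ /eqP ox] | [a _ /eqP oa]].
  exists (x.1 ^+ #|bT|); rewrite ?inE // -(order_pairg1 bT) -ox.
  have <-: x ^+ #|bT| = (x.1 ^+ #|bT|, 1).
    by rewrite expg_pair -cardsT (expg_cardG (in_setT x.2)).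
  by rewrite orderXgcd ox (eqnP co_n) divn1.
by exists (a, 1); rewrite ?inE // order_pairg1 oa.
Qed.

(** The last hypothesis says that [q] is adjacent in ['S_m] to all the other
vertices, so that the edges at [q] contributed by the factor [K] are
already there.  Passing from ['S_m] to ['S_m.+1] could only add edges with
[p + r = m.+1].  As [m.+1] is odd, one of [p], [r] is then 2 and the other is
[m.-1], which is too close to [m] for the last hypothesis to hold. *)
Lemma OD_equal_Sym_prod m q (K : finGroupType) :
    prime q -> odd q -> q <= m -> q.-group [set: K] -> #|K| = m.+1 ->
    (forall r, prime r -> r <= m -> r != q -> r + q <= m) ->
  OD_equal [set: 'S_m * K]%G [set: 'S_m.+1]%G.
Proof.
move=> pr_q odd_q le_qm qK oK far_q.
have oG : #|[set: 'S_m * K]| = #|[set: 'S_m.+1]|.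
  by rewrite !cardsT card_prod !card_Sn oK factS mulnC.
apply: OD_equal_prime_graph => // p r.
have [i oKq] : exists i, m.+1 = (q ^ i)%N.
  by have [i] := p_natP qK; rewrite cardsT oK => ->; exists i.
have q_m : q %| m.+1.
  case: i oKq => [[m0] | i ->]; last by rewrite expnS dvdn_mulr.
  by move: le_qm; rewrite m0 leqNgt prime_gt0.
(* [m.+1] is not a prime: its only prime divisor is [q <= m]. *)
have le_m s : prime s -> (s <= m.+1) = (s <= m).
  move=> pr_s; rewrite leq_eqVlt orb_idl // => /eqP sm.
  move: q_m; rewrite -sm dvdn_prime2 // => /eqP qs.
  by rewrite qs sm ltnn in le_qm.
have sum_neq s t : prime s -> prime t -> s != q -> t != q -> s + t != m.+1.
  have odd_m : odd m.+1 by rewrite oKq oddX odd_q orbT.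
  have sum2_neq u : prime u -> u != q -> u + 2 != m.+1.
    move=> pr_u neq_uq; apply/eqP=> um; have := prime_gt1 pr_q.
    by have := far_q u pr_u _ neq_uq; lia.
  move=> pr_s pr_t neq_sq neq_tq; apply/eqP=> stm.
  case: (even_prime pr_s) => [s2|odd_s].
    by have /eqP[] := sum2_neq t pr_t neq_tq; rewrite addnC -s2.
  case: (even_prime pr_t) => [t2|odd_t].
    by have /eqP[] := sum2_neq s pr_s neq_sq; rewrite -t2.
  by move: odd_m; rewrite -stm oddD odd_s odd_t.
have ex_q s : prime s -> s <= m -> s != q ->
    [exists x in [set: 'S_m * K], #[x] == (s * q)%N].
  move=> pr_s le_sm neq_sq.
  have: [exists x in [set: 'S_m], #[x] == (s * q)%N].
    by rewrite exists_perm_order_mul_primes // card_ord far_q.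
  case/exists_inP=> x _ ox; apply/exists_inP; exists (x, 1); rewrite ?inE //.
  by rewrite order_pairg1.
rewrite prime_graph_Sym {1}/prime_graph oG cardsT card_Sn !mem_primes_fact.
case: (boolP (prime p)) => //= pr_p.
case: (boolP (prime r)) => [pr_r | _]; last by rewrite andbF.
case: (eqVneq p r) => [-> | neq_pr]; rewrite ?andbF //= (le_m p) // (le_m r) //.
have [le_pm | gt_pm] := leqP p m; last by have := prime_gt1 pr_r; lia.
have [le_rm | gt_rm] := leqP r m; last by have := prime_gt1 pr_p; lia.
have [eq_pq | neq_pq] := eqVneq p q.
  have neq_rq : r != q by rewrite -eq_pq eq_sym.
  by rewrite eq_pq mulnC ex_q // addnC leqW // far_q.
have [eq_rq | neq_rq] := eqVneq r q.
  by rewrite eq_rq ex_q // leqW // far_q.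
rewrite exists_order_prod; last first.
  by rewrite oK oKq coprimeMl !coprimeXr // prime_coprime ?dvdn_prime2.
rewrite exists_perm_order_mul_primes // card_ord.
by have := sum_neq p r pr_p pr_r neq_pq neq_rq; lia.
Qed.

(** * Recovering the factor from the centre *)

Lemma center_prod_isog (aT bT : finGroupType) :
    'Z([set: aT]) = 1 -> abelian [set: bT] ->
  [set: bT] \isog 'Z([set: aT * bT]).
Proof.
move=> Za1 cbb.
have -> : 'Z([set: aT * bT]) = pair1g aT (gT2 := bT) @* [set: bT].
  rewrite morphim_pair1g; apply/setP=> [[a b]].
  apply/centerP/setXP => [[_ cab] | [/set1P-> _]].
    split; rewrite ?inE // -in_set1 -[[set 1]]/(1 : {set aT}) -Za1.
    apply/centerP; split=> [|c _]; rewrite ?inE //.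
    by have [] := cab (c, 1) (in_setT _).
  split=> [|[c d] _]; rewrite ?inE // /commute; congr (_, _).
    by rewrite /= mul1g mulg1.
  exact: (centsP cbb).
by rewrite sub_isog ?injm_pair1g.
Qed.

(** If [s] moves [x], choose [y] outside [{x, s x}]: then [s] does not commute
with the transposition of [x] and [y], which fixes [s x]. *)
Lemma center_Sym n : 2 < n -> 'Z([set: 'S_n]) = 1.
Proof.
move=> gt2n; apply/trivgP/subsetP=> s /centerP[_ cs].
apply/set1P/permP=> x; rewrite perm1; apply/eqP/negPn/negP=> nfix.
have /subsetPn[y _] : ~~ ([set: 'I_n] \subset [set x; s x]).
  apply: contraL gt2n => /subset_leq_card.
  by rewrite cardsT card_ord cards2 -leqNgt => /leq_trans-> //; case: eqP.
rewrite !inE negb_or => /andP[neq_yx neq_ysx].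
have := congr1 (fun t : 'S_n => t x) (cs (tperm x y) (in_setT _)).
rewrite /= !permM tpermL (tpermD _ neq_ysx) 1?eq_sym // => /perm_inj eq_xy.
by rewrite eq_xy eqxx in neq_yx.
Qed.

(** * Counting the groups *)

Lemma leq_hOD (gT : finGroupType) (H : {group gT}) n
    (aT : 'I_n -> finGroupType) (G : forall i, {group aT i}) :
    (forall i, OD_equal (G i) H) ->
    (forall i j, G i \isog G j -> i = j) ->
  n <= hOD H.
Proof.
move=> odG injG; have [rT [r [_ _ rP]]] := hOD_spec H.
have /fin_all_exists[f fP] i := rP _ (G i) (odG i).
rewrite -[n]card_ord -[hOD H]card_ord; apply: (@leq_card _ _ f) => i j eq_fij.
by apply/injG/(isog_trans (fP i)); rewrite eq_fij isog_sym.
Qed.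

(** For [i < n] this is the abelian group of order [p ^ n] with invariants
[p ^ i.+1, p, ..., p], a family in which the exponent separates the members. *)
Definition Zp_vec p n i : finGroupType :=
  ('Z_(p ^ i.+1)%N * 'rV['F_p]_(n - i.+1))%type.

Lemma card_Zp_vec p n i : prime p -> i < n -> #|Zp_vec p n i| = (p ^ n)%N.
Proof.
move=> pr_p lt_in.
rewrite card_prod card_ord card_mx card_Fp // mul1n Zp_cast; last first.
  by rewrite -{1}(exp1n i.+1) ltn_exp2r ?prime_gt1.
by rewrite -expnD subnKC.
Qed.

Lemma abelian_Zp_vec p n i : abelian [set: Zp_vec p n i].
Proof.
by apply/centsP=> [[a b] _ [c d] _]; congr (_, _); apply: FinRing.zmod_mulgC.
Qed.

Lemma exponent_Zp_vec p n i :
  prime p -> exponent [set: Zp_vec p n i] = (p ^ i.+1)%N.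
Proof.
move=> pr_p; have gt1 : 1 < (p ^ i.+1)%N.
  by rewrite -{1}(exp1n i.+1) ltn_exp2r ?prime_gt1.
apply/eqP; rewrite eqn_dvd; apply/andP; split.
  apply/exponentP=> [x _]; rewrite expg_pair; congr (_, _).
    by have := expg_cardG (in_setT x.1); rewrite cardsT card_ord (Zp_cast gt1).
  rewrite FinRing.zmodXgE -GRing.scaler_nat.
  by rewrite GRing.natrX pchar_Fp_0 // GRing.exprS GRing.mul0r GRing.scale0r.
rewrite -[X in X %| _](Zp_cast gt1) -(order_Zp1 (Zp_trunc _).+1).
rewrite -(order_pairg1 ('rV['F_p]_(n - i.+1))).
exact: dvdn_exponent (in_setT _).
Qed.

Lemma hOD_Sym_3exp n :
  1 < n -> ~~ prime ((3 ^ n)%N - 2) -> n <= hOD [set: 'S_(3 ^ n)%N]%G.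
Proof.
move=> gt1n npr.
have m_gt0 : 0 < (3 ^ n)%N by rewrite expn_gt0.
case Dm: (3 ^ n)%N npr m_gt0 => [|m] // npr _.
have m_ge8 : 8 <= m by rewrite -ltnS -Dm -[9]/(3 ^ 2)%N leq_exp2l.
pose gT (i : 'I_n) : finGroupType := ('S_m * Zp_vec 3 n i)%type.
apply: (@leq_hOD _ _ n gT (fun i => [set: gT i]%G)).
  move=> i; have oK : #|Zp_vec 3 n i| = m.+1 by rewrite card_Zp_vec.
  apply: (@OD_equal_Sym_prod m 3) => //.
  - exact: leq_trans m_ge8.
  - by rewrite /pgroup cardsT oK -Dm pnatX.
  (* A prime [r] with [m - 3 < r <= m] would be one of [m], which is even,
     [m.-1 = 3 ^ n - 2], which is composite, and [m - 2], a multiple of 3. *)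
  move=> r pr_r le_rm neq_r3; rewrite leqNgt; apply/negP=> lt_mr3.
  have odd_m : odd m.+1 by rewrite -Dm oddX orbT.
  have m3 : 3 %| m.+1 by rewrite -Dm dvdn_exp // ltnW.
  have neq_rm : r != m.-1.
    by apply: contraNneq npr => rm; have <- : r = m.+1 - 2 by lia.
  have odd_r : odd r by case: (even_prime pr_r) => // r2; lia.
  have : 3 %| r by lia.
  by rewrite dvdn_prime2 // eq_sym (negPf neq_r3).
move=> i j /isog_center isoZ; apply/val_inj/eqP; rewrite -eqSS.
have Z1 : 'Z([set: 'S_m]) = 1 by rewrite center_Sym ?(leq_trans _ m_ge8).
have iZ k := center_prod_isog Z1 (abelian_Zp_vec 3 n k).
have/exponent_isog := isog_trans (isog_trans (iZ i) isoZ) (isog_symr (iZ j)).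
by rewrite !exponent_Zp_vec // => /eqP; rewrite eqn_exp2l.
Qed.

Lemma pow3_sub2_not_prime k : ~~ prime ((3 ^ (4 * k + 3))%N - 2).
Proof.
have ge27 : 27 <= (3 ^ (4 * k + 3))%N.
  by rewrite -[27]/(3 ^ 3)%N leq_exp2l ?leq_addl.
have mod5 : (3 ^ (4 * k + 3))%N = 2 %[mod 5].
  by rewrite expnD expnM -modnMml -modnXm exp1n.
apply/negP=> pr_m; have : 5 %| (3 ^ (4 * k + 3))%N - 2.
  by rewrite -eqn_mod_dvd ?mod5 // (leq_trans _ ge27).
rewrite dvdn_prime2 // => /eqP; lia.
Qed.

Theorem theorem1p10 :
  (forall n : nat, exists2 m : nat, n < m & 3 < hOD [set: 'S_m]%G)
  /\ (forall N : nat, exists m : nat, N < hOD [set: 'S_m]%G).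
Proof.
have many k : (4 * k)%N + 3 <= hOD [set: 'S_(3 ^ (4 * k + 3))%N]%G.
  by apply: hOD_Sym_3exp; rewrite ?pow3_sub2_not_prime // addnC.
split=> [n | N].
  exists (3 ^ (4 * n.+1 + 3))%N; last by apply: leq_trans (many _); lia.
  by apply: leq_ltn_trans (ltn_expl _ _); lia.
by exists (3 ^ (4 * N + 3))%N; apply: leq_trans (many _); lia.
Qed.
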